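(* Let $n\ge 1$. The (Poisson) center of the Poisson field $\mathbb{C}(M_n)$ of rational functions on $(M_n,\pi_n)$ is $$\mathbb{C}\big(\Delta_{n;1}/\Delta'_{n;n-1},\ \ldots,\ \Delta_{n;n-1}/\Delta'_{n;1},\ \Delta_n\big),$$ i.e. the subfield of $\mathbb{C}(M_n)$ generated over $\mathbb{C}$ by $\Delta_{n;k}/\Delta'_{n;n-k}$, $1\le k\le n-1$, and $\Delta_n$.
   Context: $M_n$ is the space of complex $n\times n$ matrices with coordinate functions $x_{ij}$, equipped with the quadratic Poisson structure $$\pi_n=\sum_{i,k=1}^n\sum_{j,l=1}^n(\mathrm{sign}(k-i)+\mathrm{sign}(l-j))\,x_{il}x_{kj}\,\frac{\partial}{\partial x_{ij}}\wedge\frac{\partial}{\partial x_{kl}},$$ where $\mathrm{sign}(a)=1,0,-1$ according to $a>0$, $a=0$, $a<0$; the bracket is normalized by $\{x_{ij},x_{kl}\}=(\mathrm{sign}(k-i)+\mathrm{sign}(l-j))x_{il}x_{kj}$. It extends to the field $\mathbb{C}(M_n)$ of rational functions, making it a Poisson field; its Poisson center is the set of $f\in\mathbb{C}(M_n)$ with $\{f,g\}=0$ for all $g\in\mathbb{C}(M_n)$. For index sets $I,J$ with $|I|=|J|$, $\Delta_{I,J}(X)$ is the determinant of the submatrix of $X$ with rows $I$ and columns $J$; $[a,b]=\{a,a+1,\ldots,b\}$. For $1\le k<n$, $\Delta_{n;k}=\Delta_{[1,k],[n-k+1,n]}$ and $\Delta'_{n;k}=\Delta_{[n-k+1,n],[1,k]}$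 are the upper-right and lower-left $k\times k$ minors, and $\Delta_n=\det$. *)

(* Defs.v *)
From HB Require Import structures.
From mathcomp Require Import all_boot all_order all_algebra.
From mathcomp Require Import generic_quotient.
From mathcomp Require Import mpoly complex ring.
From mathcomp Require Import reals.

Set Implicit Arguments.
Unset Strict Implicit.
Unset Printing Implicit Defensive.

Import GRing.Theory Num.Theory.
Local Open Scope ring_scope.

(* The coordinate ring of the complex n x n matrices, in n * n variables: x_ij
   is 'X_(mxvec_index i j), and every variable is of this form. *)
Notation matpoly R n := {mpoly (complex R)[n * n]}.

Notation ratfun R n := {fraction (matpoly R n)}.

Section MatrixPoisson.
Variables (R : realType) (n : nat).
Local Notation P := (matpoly R n).
Local Notation K := (ratfun R n).
Local Notation "p %:F" := (@FracField.tofrac P p).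

Definition ratfun_const (c : complex R) : K := (c%:MP_[n * n])%:F.

Definition coordmx : 'M[K]_n := \matrix_(i, j) ('X_(mxvec_index i j))%:F.

Definition quotient_rule (D : P -> P) (p q : P) : K :=
  (D p * q - p * D q)%:F / (q ^+ 2)%:F.

(* The partial derivative with respect to x_ij, computed from the chosen
   representative of f; by pdiffE any other one gives the same value. *)
Definition pdiff (i j : 'I_n) (f : K) : K :=
  quotient_rule (mderiv (mxvec_index i j)) \n_(repr f) \d_(repr f).

(* The coefficients change sign under (i, j) <-> (k, l), so this sum over all
   indices is the skew biderivation with the values given by poisson_coord. *)
Definition poisson (f g : K) : K :=
  \sum_(i < n) \sum_(j < n) \sum_(k < n) \sum_(l < n)
    (sgz (k%:Z - i%:Z) + sgz (l%:Z - j%:Z))%:~R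
      * (coordmx i l * coordmx k j) * (pdiff i j f * pdiff k l g).

Definition poisson_center (f : K) : Prop := forall g : K, poisson f g = 0.

(* Rows I and columns J, both in increasing order; meant for #|I| = #|J|, in
   which case the default value of nth is never used. *)
Definition minor (I J : {set 'I_n}) : K :=
  \det (\matrix_(a < #|I|, b < #|I|)
    coordmx (enum_val a) (nth (enum_val a) (enum J) b)).

(* The bounds count from 1, while the elements of 'I_n count from 0. *)
Definition interval (a b : nat) : {set 'I_n} :=
  [set i : 'I_n | (a <= i.+1 <= b)%N].

Definition upper_right_minor (k : nat) : K :=
  minor (interval 1 k) (interval (n - k + 1) n).

Definition lower_left_minor (k : nat) : K :=
  minor (interval (n - k + 1) n) (interval 1 k).

(* The smallest subfield containing the constants and S. *)
Definition generated_subfield (S : K -> Prop) (f : K) : Prop :=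
  forall F : {pred K},
    GRing.divring_closed F -> (forall c, ratfun_const c \in F) ->
    (forall g, S g -> g \in F) -> f \in F.

Lemma ratfunE (x : {ratio P}) : (\pi_K x)%qT = (\n_x)%:F / (\d_x)%:F.
Proof.
have dx0 : \d_x != 0 by apply: denom_ratioP.
have dF0 : (\d_x)%:F != 0 by rewrite tofrac_eq0.
apply: (mulIf dF0); rewrite divfK //; unlock FracField.tofrac.
rewrite -[LHS]FracField.pi_mul /FracField.mulf; apply/eqmodP => /=.
rewrite FracField.equivfE !numden_Ratio ?mulf_neq0 ?oner_eq0 //.
by rewrite !mulr1 mulrC.
Qed.

Lemma pdiffE (i j : 'I_n) (p q : P) : q != 0 ->
  pdiff i j (p%:F / q%:F) = quotient_rule (mderiv (mxvec_index i j)) p q.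
Proof.
move=> q0; rewrite /pdiff; set f := p%:F / q%:F.
set a := \n_(repr f); set d := \d_(repr f).
have d0 : d != 0 by apply: denom_ratioP.
have adE : a * q = p * d.
  have : f = a%:F / d%:F by rewrite -ratfunE reprK.
  rewrite /f => /eqP; rewrite eqr_div ?tofrac_eq0 // -!tofracM tofrac_eq.
  by move/eqP.
rewrite /quotient_rule; apply/eqP.
rewrite eqr_div ?tofrac_eq0 ?expf_neq0 // -!tofracM tofrac_eq; apply/eqP.
move: (congr1 (mderiv (mxvec_index i j)) adE); rewrite !mderivM.
move: (mderiv _ a) (mderiv _ q) (mderiv _ p) (mderiv _ d) => Da Dq Dp Dd DE.
have -> : (Da * d - a * Dd) * q ^+ 2 =
  (Da * q + a * Dq) * d * q - (a * q) * (Dq * d + Dd * q) by ring.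
by rewrite DE adE; ring.
Qed.

Lemma pdiff_coord (i j k l : 'I_n) :
  pdiff i j (coordmx k l) = ((i == k) && (j == l))%:R.
Proof.
rewrite mxE -[_%:F]divr1 -tofrac1 pdiffE ?oner_eq0 // /quotient_rule.
rewrite -mpolyC1 mderivC mulr0 subr0 mpolyC1 expr1n mulr1 tofrac1 divr1.
rewrite mderivX mnmE.
have -> : (mxvec_index k l == mxvec_index i j) = (i == k) && (j == l).
  apply/eqP/andP => [ekl|[/eqP-> /eqP->] //].
  have := congr1 (fun m => mxvec (delta_mx i j : 'M[int]_n) 0 m) ekl.
  by rewrite !mxvecE !mxE !eqxx [k == i]eq_sym [l == j]eq_sym; do 2 case: eqP.
case: andP => [[/eqP-> /eqP->]|_]; last by rewrite scale0r tofrac0.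
by rewrite scale1r -{1}[U_(_)%MM]addm0 addmC addmK mpolyX0 tofrac1.
Qed.

Lemma poisson_coord (i j k l : 'I_n) :
  poisson (coordmx i j) (coordmx k l)
  = (sgz (k%:Z - i%:Z) + sgz (l%:Z - j%:Z))%:~R * (coordmx i l * coordmx k j).
Proof.
pose c (i' j' k' l' : 'I_n) : K :=
  (sgz (k'%:Z - i'%:Z) + sgz (l'%:Z - j'%:Z))%:~R
    * (coordmx i' l' * coordmx k' j').
have sumE (F : 'I_n -> K) (a : 'I_n) :
    \sum_(b < n) F b * (b == a)%:R = F a.
  rewrite (bigD1 a) //= eqxx mulr1 big1 ?addr0 // => b /negPf ->.
  by rewrite mulr0.
rewrite -[RHS]/(c i j k l) -[RHS](sumE (fun i' => c i' j k l) i).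
apply: eq_bigr => i' _.
rewrite -(sumE (fun j' => c i' j' k l) j) mulr_suml; apply: eq_bigr => j' _.
rewrite -(sumE (fun k' => c i' j' k' l) k) !mulr_suml; apply: eq_bigr => k' _.
rewrite -(sumE (fun l' => c i' j' k' l') l) !mulr_suml; apply: eq_bigr => l' _.
rewrite !pdiff_coord -/(c i' j' k' l') -!mulnb !natrM.
move: (c _ _ _ _) (_ == i)%:R (_ == j)%:R (_ == k)%:R (_ == l)%:R.
by move=> x u v w z; ring.
Qed.
End MatrixPoisson.

(* Main.v *)
(* Sweeping the last row of X by x'_kl = x_kl - x_{k,l+1} x_ml / x_{m,l+1}
   (column operations between neighbours that leave only the last entry of row m)
   gives a matrix with one row less and the same brackets, and x'_kl commutes
   with x_mj up to the log-canonical term delta_lj x'_kl x_mj.  Iterating, the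
   successive pivot rows form coordinates t_kl of the field with
     {t_kl, t_pq} = (sign(p - k) delta_lq + delta_kp sign(q - l)) t_kl t_pq.
   A Laurent monomial t^V thus has weight V S - S V, S being the sign matrix, so
   the central monomials are those with V in the commutant of S, which consists
   of the negacyclic matrices.  The d-th power of the negacyclic shift gives the
   quotient of the products of t along the diagonals j = i + d and
   i = j + (n - d); by unipotence of the column operations, these products are
   the corner minors.  Finally, a central f = p / q with Laurent polynomials p, q
   satisfies f q_w = p_w for the components of every weight w, and dividing
   p_w and q_w by a monomial of weight w leaves central monomials only. *)
Require Import Defs.
From mathcomp Require Import all_boot all_order all_algebra.
From mathcomp Require Import mpoly complex reals.
From mathcomp Require Import boolp ring zify.
Set Implicit Arguments.
Unset Strict Implicit.
Unset Printing Implicit Defensive.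

Import GRing.Theory Num.Theory.
Local Open Scope ring_scope.

(** * Derivations and weights *)

(** [Prop]-valued, so that centralizers are instances directly; the final theorem passes to boolean
    predicates through [asbool]. *)
Definition subfield (K : fieldType) (G : K -> Prop) :=
  [/\ G 1, forall f g, G f -> G g -> G (f - g)
    & forall f g, G f -> G g -> G (f / g)].

Section Subfield.
Variables (K : fieldType) (G : K -> Prop).
Hypothesis GK : subfield G.

Lemma subfield1 : G 1. Proof. by case: GK. Qed.

Lemma subfieldB f g : G f -> G g -> G (f - g).
Proof. by case: GK => _ + _; apply. Qed.

Lemma subfield_div f g : G f -> G g -> G (f / g).
Proof. by case: GK => _ _; apply. Qed.

Lemma subfield0 : G 0.
Proof. by rewrite -(subrr 1); apply: subfieldB subfield1 subfield1. Qed.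

Lemma subfieldD f g : G f -> G g -> G (f + g).
Proof.
move=> Gf Gg; rewrite -[g]opprK -[- g]sub0r.
by apply: subfieldB Gf (subfieldB subfield0 Gg).
Qed.

Lemma subfieldV f : G f -> G f^-1.
Proof. by rewrite -div1r; apply: subfield_div subfield1. Qed.

Lemma subfieldM f g : G f -> G g -> G (f * g).
Proof.
by move=> Gf Gg; rewrite -[g]invrK; apply: subfield_div Gf (subfieldV Gg).
Qed.

Lemma subfield_int (z : int) : G z%:~R.
Proof.
have Gnat k : G k%:R.
  elim: k => [|k IH]; first exact: subfield0.
  by rewrite -natr1; apply: subfieldD subfield1.
case: z => k; first exact: Gnat.
by rewrite NegzE rmorphN /= -sub0r; apply: subfieldB subfield0 (Gnat _).
Qed.

Lemma subfield_sum (I : Type) (s : seq I) (P : pred I) (h : I -> K) :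
  (forall i, P i -> G (h i)) -> G (\sum_(i <- s | P i) h i).
Proof. by move=> Gh; apply: big_ind => //; [apply: subfield0|apply: subfieldD]. Qed.

Lemma subfield_prod (I : eqType) (s : seq I) (h : I -> K) :
  (forall i, i \in s -> G (h i)) -> G (\prod_(i <- s) h i).
Proof.
move=> Gh; rewrite big_seq; apply: big_ind => //; first exact: subfield1.
exact: subfieldM.
Qed.

Lemma subfieldX f k : G f -> G (f ^+ k).
Proof.
move=> Gf; elim: k => [|k IH]; first by rewrite expr0; apply: subfield1.
by rewrite exprS; apply: subfieldM.
Qed.

Lemma subfield_exprz f (z : int) : G f -> G (f ^ z).
Proof.
by case: z => k Gf; [apply: subfieldX | apply/subfieldV/subfieldX].
Qed.
End Subfield.

Definition derivation (K : fieldType) (D : K -> K) :=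
  (forall f g, D (f + g) = D f + D g) /\
  (forall f g, D (f * g) = D f * g + f * D g).

Section Derivation.
Variables (K : fieldType) (D : K -> K).
Hypothesis DD : derivation D.

Lemma derivationD f g : D (f + g) = D f + D g. Proof. by case: DD. Qed.
Lemma derivationM f g : D (f * g) = D f * g + f * D g. Proof. by case: DD. Qed.

Lemma derivation0 : D 0 = 0.
Proof. by apply: (addIr (D 0)); rewrite -derivationD !add0r. Qed.

Lemma derivationN f : D (- f) = - D f.
Proof. by apply/eqP; rewrite -addr_eq0 -derivationD addNr derivation0. Qed.

Lemma derivationB f g : D (f - g) = D f - D g.
Proof. by rewrite derivationD derivationN. Qed.

Lemma derivation1 : D 1 = 0.
Proof.
by apply: (addIr (D 1)); rewrite add0r -{3}(mulr1 1) derivationM mulr1 mul1r.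
Qed.

Lemma derivationV f : f != 0 -> D f^-1 = - (D f / f ^+ 2).
Proof.
move=> f0; apply: (mulfI f0); apply: (addrI (D f * f^-1)).
rewrite -derivationM divff // derivation1; field; exact: f0.
Qed.

Lemma deriv_sum (I : Type) (s : seq I) (P : pred I) (h : I -> K) :
  D (\sum_(i <- s | P i) h i) = \sum_(i <- s | P i) D (h i).
Proof. exact: (big_morph D derivationD derivation0). Qed.

Lemma deriv_weightX w f k : D f = w * f -> D (f ^+ k) = k%:R * w * f ^+ k.
Proof.
move=> Df; elim: k => [|k IH]; first by rewrite expr0 derivation1 !mul0r.
rewrite exprS derivationM IH Df -natr1; ring.
Qed.

Lemma deriv_weightXz w f (z : int) : f != 0 ->
  D f = w * f -> D (f ^ z) = z%:~R * w * f ^ z.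
Proof.
move=> f0 Df; case: z => k; first exact: deriv_weightX.
have fk0 : f ^+ k.+1 != 0 by apply: expf_neq0.
rewrite -[f ^ _]/((f ^+ k.+1)^-1) NegzE rmorphN /= derivationV //.
rewrite (deriv_weightX _ Df) -pmulrn; field; exact: fk0.
Qed.

Lemma deriv_weight_prod (I : finType) (w h : I -> K) :
  (forall i, D (h i) = w i * h i) ->
  D (\prod_i h i) = (\sum_i w i) * \prod_i h i.
Proof.
move=> Dh.
apply: (big_ind2 (fun y x => D x = y * x)) => //.
  by rewrite derivation1 mul0r.
move=> y x y' x' Dx Dx'; rewrite derivationM Dx Dx'; ring.
Qed.

(** With one argument of a bracket fixed, this makes centralizers subfields; through [subfield_int]
    it also shows that derivations kill integers. *)
Lemma subfield_deriv_ker : subfield (fun f => D f = 0).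
Proof.
split=> [|f g Df Dg|f g Df Dg]; first exact: derivation1.
  by rewrite derivationB Df Dg subrr.
have [->|g0] := eqVneq g 0; first by rewrite invr0 mulr0 derivation0.
by rewrite derivationM derivationV // Df Dg !(mul0r, mulr0, oppr0, addr0).
Qed.
End Derivation.

Section WeightSpaces.
Variables (K : fieldType) (A : Type) (D : A -> K -> K) (W : eqType).
Variables (ev : W -> A -> K) (I : Type) (wt : I -> W).
Hypothesis D_der : forall a, derivation (D a).
Hypothesis D_ev : forall w a b, D b (ev w a) = 0.
Hypothesis ev_inj : forall w w', w != w' -> exists a, ev w a != ev w' a.

(* Independence of joint eigenvectors of different weights: if w' is another
   weight of the family, D_a - ev w' a kills its components for a suitable a. *)
Lemma weight_component0 (s : seq I) (h : I -> K) (w : W) :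
  (forall i a, D a (h i) = ev (wt i) a * h i) ->
  \sum_(i <- s) h i = 0 -> \sum_(i <- s | wt i == w) h i = 0.
Proof.
have : all (fun i => wt i \in w :: map wt s) s.
  elim: s => //= i s IH; rewrite !inE eqxx orbT /=.
  by apply: sub_all IH => j; rewrite !inE => /orP[->//|->]; rewrite !orbT.
(* Induction on a list [L] which, together with [w], contains all weights that occur. *)
move: (map wt s) => L sL Dh hs.
move: L s h sL Dh hs; elim=> [|w' L IH] s h sL Dh hs.
  rewrite -big_filter; have /all_filterP -> // : all (fun i => wt i == w) s.
  by apply: sub_all sL => i; rewrite inE.
have [ww'|/ev_inj[a wa]] := eqVneq w w'.
  by apply: IH => //; apply: sub_all sL => i; rewrite ww' !inE orbA orbb.
pose h' i := (ev (wt i) a - ev w' a) * h i.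
have Dh' i b : D b (h' i) = ev (wt i) b * h' i.
  rewrite /h' derivationM // derivationB // !D_ev Dh; ring.
have hs' : \sum_(i <- [seq i <- s | wt i != w']) h' i = 0.
  have := congr1 (D a) hs; rewrite deriv_sum // derivation0 // => Dhs.
  have hs0 : \sum_(i <- s) h' i = 0.
    under eq_bigr do rewrite /h' mulrBl -Dh.
    by rewrite sumrB Dhs -mulr_sumr hs mulr0 subrr.
  rewrite big_filter -[RHS]hs0 [RHS](bigID (fun i => wt i == w')) /=.
  by rewrite [X in X + _]big1 ?add0r // => i /eqP wi; rewrite /h' wi subrr mul0r.
have sL' : all (fun i => wt i \in w :: L) [seq i <- s | wt i != w'].
  rewrite all_filter; apply: sub_all sL => i /=; rewrite !inE.
  by case: eqVneq => //= _; case: eqVneq.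
have := IH _ _ sL' Dh' hs'.
rewrite big_filter_cond /= (eq_bigl (fun i => wt i == w)); last first.
  move=> i /=; have [->|] := eqVneq (wt i) w; last by rewrite andbF.
  by rewrite andbT; apply: contraNneq wa => ->.
under eq_bigr => i /eqP wi do rewrite /h' wi.
rewrite -mulr_sumr => /eqP; rewrite mulf_eq0 subr_eq0 (negPf wa) /=.
by move/eqP.
Qed.
End WeightSpaces.

Lemma sum_weight_components (V : nmodType) (I : Type) (W : eqType)
    (wt : I -> W) (s : seq I) (h : I -> V) :
  (forall w, \sum_(i <- s | wt i == w) h i = 0) -> \sum_(i <- s) h i = 0.
Proof.
move=> h0; pose L := undup (map wt s).
have -> : \sum_(i <- s) h i = \sum_(w <- L) \sum_(i <- s | wt i == w) h i.
  under [RHS]eq_bigr do rewrite big_mkcond.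
  rewrite exchange_big /=.
  have : {subset map wt s <= L} by move=> w; rewrite mem_undup.
  have : uniq L by apply: undup_uniq.
  move: L; elim: s {h0} => [|i s IH] L uL sL; first by rewrite !big_nil.
  rewrite !big_cons (IH L) //; last by move=> w ws; apply: sL; rewrite inE ws orbT.
  rewrite (bigD1_seq (wt i)) ?eqxx ?sL ?inE ?eqxx //=.
  by congr (_ + _); rewrite big1 ?addr0 // => w; rewrite eq_sym => /negPf ->.
by rewrite big1.
Qed.

(** Over the common denominator [b * b'], the quotient rule turns additivity and the Leibniz rule
    into field identities. *)
Lemma quotient_derivation (A : comNzRingType) (K : fieldType)
    (phi : {rmorphism A -> K}) (d : A -> A) (D : K -> K) :
  (forall p q, d (p + q) = d p + d q) ->
  (forall p q, d (p * q) = d p * q + p * d q) ->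
  (forall f, exists p q, phi q != 0 /\ f = phi p / phi q) ->
  (forall p q, phi q != 0 -> D (phi p / phi q) =
     (phi (d p) * phi q - phi p * phi (d q)) / phi q ^+ 2) ->
  derivation D.
Proof.
move=> dD dM frac Dfrac.
split=> f g; have [a [b [b0 ->]]] := frac f; have [a' [b' [b'0 ->]]] := frac g;
  have bb0 : phi (b * b') != 0 by rewrite rmorphM mulf_neq0.
- have -> : phi a / phi b + phi a' / phi b' = phi (a * b' + a' * b) / phi (b * b').
    by rewrite rmorphD !rmorphM; field; rewrite b'0.
  rewrite !Dfrac // !(dD, dM, rmorphD, rmorphM); field; rewrite ?b0 ?b'0 //.
- have -> : phi a / phi b * (phi a' / phi b') = phi (a * a') / phi (b * b').
    by rewrite !rmorphM; field; rewrite b'0.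
  by rewrite !Dfrac // !(dD, dM, rmorphD, rmorphM); field; rewrite b'0.
Qed.

(** * Sweeping a row *)

Definition sg (i j : nat) : int := sgz (j%:Z - i%:Z).

Lemma sgxx i : sg i i = 0. Proof. by rewrite /sg subrr. Qed.
Lemma sg_lt i j : (i < j)%N -> sg i j = 1.
Proof. by move=> ij; rewrite /sg gtr0_sgz // subr_gt0. Qed.
Lemma sg_gt i j : (j < i)%N -> sg i j = -1.
Proof. by move=> ij; rewrite /sg ltr0_sgz // subr_lt0. Qed.
Lemma sgC i j : sg j i = - sg i j.
Proof. by rewrite /sg -sgzN opprB. Qed.

Definition biderivation (K : fieldType) (br : K -> K -> K) :=
  (forall g, derivation (br^~ g)) /\ (forall f g, br f g = - br g f).

Section Bracket.
Variables (K : fieldType) (br : K -> K -> K).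
Hypothesis brK : biderivation br.

Lemma br_der g : derivation (br^~ g). Proof. by case: brK. Qed.
Lemma brC f g : br f g = - br g f. Proof. by case: brK. Qed.

Lemma br_derr f : derivation (br f).
Proof.
split=> g h; first by rewrite brC (derivationD (br_der f)) opprD -!brC.
by rewrite brC (derivationM (br_der f)) opprD -mulNr -mulrN -!brC.
Qed.

(** Natural indices avoid casts when rows are dropped or a right neighbour is taken; only the block
    of [m] rows and [n] columns is constrained. *)
Definition standard_bracket (m n : nat) (Y : nat -> nat -> K) :=
  forall k l p q, (k < m)%N -> (p < m)%N -> (l < n)%N -> (q < n)%N ->
    br (Y k l) (Y p q) = (sg k p + sg l q)%:~R * (Y k q * Y p l).

(* Zero in the last column, which a sweep does not change. *)
Definition next_ratio (n : nat) (y : nat -> K) (l : nat) : K :=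
  if (l.+1 < n)%N then y l / y l.+1 else 0.

Definition sweep (n m : nat) (Y : nat -> nat -> K) (k l : nat) : K :=
  Y k l - Y k l.+1 * next_ratio n (Y m) l.

Section Sweep.
Variables (m n : nat) (Y : nat -> nat -> K).
Hypothesis Ystd : standard_bracket m.+1 n Y.
Hypothesis Y0 : forall l, (l < n)%N -> Y m l != 0.
Let Z := sweep n m Y.

(** The signs [sg l j] and [sg l.+1 j] differ only for [j] equal to [l] or [l.+1]; elsewhere the
    terms of the two columns vanish or cancel. At [l.+1] the three contributions have coefficients 2
    - 1 - 1, and at [l] the swept entry itself survives. *)
Lemma sweep_last_row k l j : (k < m)%N -> (l < n)%N -> (j < n)%N ->
  br (Z k l) (Y m j) = (l == j)%:R * (Z k l * Y m j).
Proof.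
move=> km ln jn; rewrite /Z /sweep /next_ratio.
have kS := leqW km; have mS := ltnSn m.
have skm := sg_lt km.
case: ifP => lSn; last first.
  have lE : l = n.-1 by lia.
  rewrite mulr0 subr0 Ystd // skm.
  case: eqVneq => [->|lj]; first by rewrite sgxx addr0.
  by rewrite (@sg_gt l j) ?subrr ?mul0r //; lia.
rewrite !(derivationB (br_der _), derivationM (br_der _)).
rewrite (derivationV (br_der _)) ?Y0 //.
rewrite !Ystd // skm sgxx !add0r.
have l0 := Y0 ln; have l10 := Y0 lSn.
case: (ltngtP l j) => lj /=; rewrite ?mul0r ?mul1r.
- case: (ltngtP l.+1 j) => lj'; last 2 first.
  + lia.
  + subst j; rewrite sgxx sg_lt //; field; exact: l10.
  rewrite !sg_lt //; field; exact: l10.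
- rewrite !sg_gt //; last lia; field; exact: l10.
- subst j; rewrite sgxx sg_gt //; field; exact: l10.
Qed.

(** By antisymmetry [l <= q]. Then, by [sweep_last_row], [Z k l] meets the ratio of column [q] only
    through its numerator, and only if [l = q]; the rest is an expansion in entries of [Y]. *)
Lemma sweep_standard : standard_bracket m n Z.
Proof.
have main k l p q : (k < m)%N -> (p < m)%N -> (l < n)%N -> (q < n)%N ->
    (l <= q)%N -> br (Z k l) (Z p q) = (sg k p + sg l q)%:~R * (Z k q * Z p l).
  move=> km pm ln qn lq.
  have brm j : (j < n)%N -> br (Z k l) (Y m j) = (l == j)%:R * (Z k l * Y m j).
    exact: sweep_last_row.
  have kS := leqW km; have pS := leqW pm; have mS := ltnSn m.
  have spm := sg_gt pm.
  have := brm q qn.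
  (* If [l] is the last column, so is [q], and the sweep changes neither entry. *)
  case lSn: (l.+1 < n)%N; last first.
    have [-> ->] : l = n.-1 /\ q = n.-1 by lia.
    have nn : (n.-1.+1 < n)%N = false by lia.
    rewrite /Z /sweep /next_ratio nn !mulr0 !subr0 => _.
    by rewrite Ystd //; lia.
  have l0 := Y0 ln; have l10 := Y0 lSn.
  have brp j : (j < n)%N -> br (Z k l) (Y p j) =
      (sg k p + sg l j)%:~R * (Y k j * Y p l)
      - (sg k p + sg l.+1 j)%:~R * (Y k j * Y p l.+1) * (Y m l / Y m l.+1)
      - Y k l.+1 * ((-1 + sg l j)%:~R * (Y m j * Y p l) / Y m l.+1
         - Y m l * ((-1 + sg l.+1 j)%:~R * (Y m j * Y p l.+1)) / Y m l.+1 ^+ 2).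
    move=> jn; rewrite /Z /sweep /next_ratio lSn.
    rewrite !(derivationB (br_der _), derivationM (br_der _)).
    rewrite (derivationV (br_der _)) //.
    rewrite !Ystd // spm; field; exact: l10.
  have brv : br (Z k l) (next_ratio n (Y m) q) =
      (l == q)%:R * (Z k l * next_ratio n (Y m) q).
    rewrite /next_ratio; case: ifP => qSn; last first.
      by rewrite derivation0 ?mulr0 //; apply: br_derr.
    rewrite (derivationM (br_derr _)) (derivationV (br_derr _)) ?Y0 // !brm //.
    have -> : (l == q.+1) = false by lia.
    rewrite mul0r.
    have q10 := Y0 qSn; field; exact: q10.
  move=> _; rewrite [Z p q]/Z /sweep.
  rewrite (derivationB (br_derr _)) (derivationM (br_derr _)).
  rewrite {}brv brp //; move: lq; rewrite leq_eqVlt => /orP[/eqP lq|lq].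
    subst q; rewrite eqxx mul1r brp // /Z /sweep /next_ratio lSn !sgxx.
    rewrite (@sg_gt l.+1 l) //; field; exact: l10.
  have -> : (l == q) = false by lia.
  rewrite mul0r.
  have slq := sg_lt lq.
  have rl : next_ratio n (Y m) l = Y m l / Y m l.+1 by rewrite /next_ratio lSn.
  rewrite [Z k q]/Z [Z p l]/Z /sweep rl slq /next_ratio.
  (* The neighbour [l.+1] may coincide with [q], where [sg l.+1 q] is 0 instead of 1. *)
  case: (ltngtP l.+1 q) lq => // [lq _|lq _].
    rewrite (sg_lt lq); case: ifP => qSn.
      rewrite brp // (@sg_lt l q.+1) 1?(@sg_lt l.+1 q.+1) //; try lia.
      have q10 := Y0 qSn; field; rewrite l10; exact: q10.
    field; exact: l10.
  subst q; rewrite sgxx; case: ifP => qSn.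
    rewrite brp // (@sg_lt l l.+2) 1?(@sg_lt l.+1 l.+2) //.
    have q10 := Y0 qSn; field; rewrite l10; exact: q10.
  field; exact: l10.
move=> k l p q km pm ln qn; case/orP: (leq_total l q) => lq; first exact: main.
rewrite brC main // (sgC k p) (sgC l q) -opprD rmorphN /=; ring.
Qed.
End Sweep.
End Bracket.

Lemma sum_delta (V : nzRingType) (s : nat) (f : nat -> V) (j : nat) :
  \sum_(k < s) f k * (k == j :> nat)%:R = if (j < s)%N then f j else 0.
Proof.
case: ifP => js.
  rewrite (bigD1 (Ordinal js)) //= eqxx mulr1 big1 ?addr0 // => k.
  by rewrite -val_eqE /= => /negPf ->; rewrite mulr0.
rewrite big1 // => k _; have -> : (k == j :> nat) = false; last exact: mulr0.
by apply: contraFF js => /eqP <-.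
Qed.

Lemma sum_delta_lt (V : nzRingType) (s : nat) (f : nat -> V) (j : nat) :
  (j < s)%N -> f j = \sum_(k < s) f k * (k == j :> nat)%:R.
Proof. by rewrite sum_delta => ->. Qed.

(** * Pivot coordinates and solid minors *)

Section Torus.
Variables (K : fieldType) (n : nat) (X : nat -> nat -> K).

(* After r sweeps the rows k < n - r are active; pivot row k is row k of the
   stage in which it is the last active one. *)
Fixpoint sweeps (r : nat) : nat -> nat -> K :=
  if r is r'.+1 then sweep n (n - r) (sweeps r') else X.

Definition torus (k l : nat) : K := sweeps (n - k.+1) k l.

Lemma sweepsS j : (j < n)%N ->
  sweeps (n - j) = sweep n j (sweeps (n - j.+1)).
Proof.
move=> jn; rewrite (_ : n - j = (n - j.+1).+1)%N /=; last lia.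
by rewrite (_ : n - (n - j.+1).+1 = j)%N //; lia.
Qed.

(** Sweeps are undone inside [G]: the last column is unchanged, and each column further left is
    recovered from its right neighbour and a ratio of pivots. *)
Lemma subfield_torus (G : K -> Prop) : subfield G ->
  (forall k l, (k < n)%N -> (l < n)%N -> G (torus k l)) ->
  forall k l, (k < n)%N -> (l < n)%N -> G (X k l).
Proof.
move=> GK Gt.
have GY j : (j <= n)%N -> forall k l, (k < j)%N -> (l < n)%N ->
    G (sweeps (n - j) k l).
  elim: j => // j IH jn k l; rewrite ltnS leq_eqVlt => /orP[/eqP ->|kj] ln.
    exact: Gt.
  have Gr i : (i < n)%N -> G (next_ratio n (sweeps (n - j.+1) j) i).
    rewrite /next_ratio; case: ifP => [iSn ?|_ _]; last exact: subfield0.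
    by apply: subfield_div => //; apply: Gt.
  (* Induction on the distance to the last column. *)
  have -> : l = (n - (n - l.+1).+1)%N by lia.
  have : (n - l.+1 < n)%N by lia.
  elim: (n - l.+1)%N => [|i IHi] iin.
    have := IH (ltnW jn) k (n - 1)%N kj; rewrite sweepsS // /sweep.
    by rewrite /next_ratio ifF ?mulr0 ?subr0; [apply; lia|lia].
  have := IH (ltnW jn) k (n - i.+2)%N kj; rewrite sweepsS // /sweep.
  move=> /(_ ltac:(lia)) Gd.
  rewrite -[X in G X](subrK (sweeps (n - j.+1) k (n - i.+2).+1 *
    next_ratio n (sweeps (n - j.+1) j) (n - i.+2))).
  apply: subfieldD => //; apply: subfieldM => //; last by apply: Gr; lia.
  by rewrite (_ : (n - i.+2).+1 = (n - i.+1)%N); [apply: IHi; lia|lia].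
by move=> k l; have := GY n (leqnn n) k l; rewrite subnn.
Qed.

Definition solid (Y : nat -> nat -> K) (a b s : nat) : K :=
  \det (\matrix_(i < s, j < s) Y (a + i)%N (b + j)%N).

(** The operation is right multiplication by the lower unitriangular bidiagonal matrix [U]; the last
    column of the block has no right neighbour in it and stays. *)
Lemma solid_column_op (Y : nat -> nat -> K) (u : nat -> K) (a b s : nat) :
  solid Y a b s = solid (fun k l => Y k l -
    (if (l.+1 < b + s)%N then Y k l.+1 * u l else 0)) a b s.
Proof.
pose U : 'M[K]_s := \matrix_(i, j)
  ((i == j :> nat)%:R - (i == j.+1 :> nat)%:R * u (b + j)%N).
have detU : \det U = 1.
  rewrite det_trig.
    by apply: big1 => i _; rewrite mxE eqxx ltn_eqF // mul0r subr0.
  apply/is_trig_mxP => i j ij; rewrite mxE; have -> : (i == j :> nat) = false by lia.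
  have -> : (i == j.+1 :> nat) = false by lia.
  by rewrite mul0r subr0.
rewrite /solid -[LHS]mulr1 -detU -det_mulmx; congr (\det _).
apply/matrixP => i j; rewrite !mxE.
under eq_bigr do rewrite !mxE mulrBr mulrA.
rewrite sumrB -mulr_suml (sum_delta s (fun k => Y (a + i) (b + k)) j)%N.
rewrite (sum_delta s (fun k => Y (a + i) (b + k)) j.+1)%N ltn_ord -addnS ltn_add2l.
by case: ifP => // _; rewrite mul0r.
Qed.

Lemma eq_solid (Y Y' : nat -> nat -> K) a b s :
  (forall i j, (i < s)%N -> (j < s)%N -> Y (a + i) (b + j) = Y' (a + i) (b + j))%N ->
  solid Y a b s = solid Y' a b s.
Proof. by move=> YY; congr (\det _); apply/matrixP => i j; rewrite !mxE YY. Qed.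

(** In a block reaching the last column, the neighbour used by a sweep either lies in the block or
    comes with the ratio 0. *)
Lemma solid_sweep_right (Y : nat -> nat -> K) m a b s :
  (b + s = n)%N -> solid (sweep n m Y) a b s = solid Y a b s.
Proof.
move=> bs; rewrite [RHS](solid_column_op _ (next_ratio n (Y m))).
apply: eq_solid => i j _ _.
by rewrite /sweep bs; case: ifP => // jn; rewrite {1}/next_ratio jn mulr0.
Qed.

(** Column operations inside the block clear its bottom row [m] except for the last entry. In the
    remaining cofactor every column had its right neighbour in the block, so it is a column of the
    swept matrix. *)
Lemma solid_sweep_bottom (Y : nat -> nat -> K) m a b s :
  (forall l, (l < n)%N -> Y m l != 0) -> (a + s = m)%N -> (b + s < n)%N ->
  solid Y a b s.+1 = Y m (b + s)%N * solid (sweep n m Y) a b s.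
Proof.
move=> + mE; rewrite -{}mE => Y0 bsn.
rewrite (solid_column_op _ (next_ratio n (Y (a + s)%N))) {1}/solid.
rewrite (expand_det_row _ ord_max) big_ord_recr /= big1 ?add0r => [|j _]; last first.
  rewrite mxE /=; move: (cofactor _ _ _) => c.
  have js := ltn_ord j; have jn : ((b + j).+1 < n)%N by lia.
  have -> : ((b + j).+1 < b + s.+1)%N by lia.
  by rewrite /next_ratio jn mulrCA divff ?Y0 // mulr1 subrr mul0r.
rewrite mxE /= addnS ltnn subr0; congr (_ * _).
rewrite /cofactor -signr_odd oddD addbb expr0 mul1r /solid; congr (\det _).
apply/matrixP => i j; rewrite !mxE /=.
have bumpE (k : 'I_s) : bump s k = k by rewrite /bump leqNgt ltn_ord.
by rewrite !bumpE ltnS ltn_add2l ltn_ord.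
Qed.

Hypothesis sweeps0 : forall k l, (k < n)%N -> (l < n)%N -> torus k l != 0.

(** The bottom row of the block is the last active row, so each sweep splits off the pivot in the
    lower right corner. *)
Lemma solid_sweeps_bottom r a b s :
  (r <= n)%N -> (a + s = n - r)%N -> (b + s <= n)%N ->
  solid (sweeps r) a b s = \prod_(i < s) torus (a + i) (b + i).
Proof.
elim: s r => [|s IH] r rn as_ bs; first by rewrite /solid det_mx00 big_ord0.
have asn : (a + s < n)%N by lia.
have -> : r = (n - (a + s).+1)%N by lia.
have bsn : (b + s < n)%N by lia.
have Y0 l : (l < n)%N -> sweeps (n - (a + s).+1) (a + s) l != 0 by apply: sweeps0.
rewrite (solid_sweep_bottom Y0 (erefl _) bsn).
rewrite big_ord_recr mulrC; congr (_ * _).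
rewrite -sweepsS //.
apply: IH; lia.
Qed.

Lemma solid_sweeps_right r a b s :
  (b + s = n)%N -> solid (sweeps r) a b s = solid X a b s.
Proof. by move=> bs; elim: r => //= r IH; rewrite solid_sweep_right. Qed.

Lemma solid_bottom a b s : (a + s = n)%N -> (b + s <= n)%N ->
  solid X a b s = \prod_(i < s) torus (a + i) (b + i).
Proof. by move=> as_ bs; apply: (@solid_sweeps_bottom 0%N) => //; rewrite subn0. Qed.

(** The first [n - s] sweeps preserve this minor, and after them its bottom row is the last active
    one. *)
Lemma solid_right b s : (b + s = n)%N ->
  solid X 0 b s = \prod_(i < s) torus i (b + i).
Proof.
move=> bs; rewrite -(solid_sweeps_right (n - s) _ bs).
by rewrite solid_sweeps_bottom ?leq_subr ?bs //; lia.
Qed.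
End Torus.

(** * Brackets of the pivot coordinates *)

Section TorusBracket.
Variables (K : fieldType) (br : K -> K -> K) (D : nat -> nat -> K -> K).
Variables (n : nat) (X : nat -> nat -> K).
Hypothesis brK : biderivation br.
Hypothesis DK : forall k l, (k < n)%N -> (l < n)%N -> derivation (D k l).
Hypothesis XD : forall k l p q,
  (k < n)%N -> (l < n)%N -> (p < n)%N -> (q < n)%N ->
  D k l (X p q) = ((k == p) && (l == q))%:R.
Hypothesis X_std : standard_bracket br n n X.

Let Y := sweeps n X.
Let t := torus n X.

(* The pivots do not vanish because a sweep changes x_kl only by entries of
   later columns and rows, so that d t_kl / d x_kl = 1. *)
Lemma sweeps_deriv r : (r <= n)%N -> forall k l p q,
  (k < n - r)%N -> (p < n - r)%N -> (l < n)%N -> (q < n)%N ->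
  (k != p) || (l <= q)%N -> D k l (Y r p q) = ((k == p) && (l == q))%:R.
Proof.
elim: r => [|r IH] rn k l p q kr pr ln qn kplq.
  by apply: XD => //; lia.
rewrite /Y /= -/Y /sweep; set m := (n - r.+1)%N.
have kn : (k < n)%N by lia.
have DM := derivationM (DK kn ln).
rewrite (derivationB (DK kn ln)) DM IH ?(ltnW rn) //; try lia.
rewrite /next_ratio; case: ifP => qSn; last first.
  by rewrite (derivation0 (DK kn ln)) !mulr0 addr0 subr0.
have D0 j : (j < n)%N -> D k l (Y r m j) = 0.
  move=> jn; rewrite IH ?(ltnW rn) //; try lia.
  by have -> : (k == m) = false by lia.
(* The pivot has derivative 1 with respect to the coordinate at its own position. *)
have Dm0 : Y r m q.+1 != 0.
  have mn : (m < n)%N by lia.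
  have := IH (ltnW rn) m q.+1 m q.+1; rewrite !eqxx leqnn orbT.
  move=> /(_ _ _ _ _ isT) DY; apply/eqP => Y0; move: DY.
  rewrite Y0 (derivation0 (DK mn qSn)) => DY.
  by have /eqP := DY ltac:(lia) ltac:(lia) qSn qSn; rewrite eq_sym oner_eq0.
rewrite DM (derivationV (DK kn ln)) // !D0 // !mul0r oppr0 mulr0 addr0 mulr0.
rewrite IH ?(ltnW rn) //; try lia.
have -> : (k == p) && (l == q.+1) = false by lia.
by rewrite mul0r addr0 subr0.
Qed.

Lemma torus_neq0 k l : (k < n)%N -> (l < n)%N -> t k l != 0.
Proof.
move=> kn ln; apply/eqP => t0.
have := @sweeps_deriv (n - k.+1) (leq_subr _ _) k l k l.
rewrite [Y _ _ _]t0 (derivation0 (DK kn ln)) !eqxx leqnn orbT.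
by move=> /(_ ltac:(lia) ltac:(lia) ln ln isT)/eqP; rewrite eq_sym oner_eq0.
Qed.

(** The new pivot row is [sweep_last_row]. For an older one, all terms of a swept entry have the
    same log-canonical weight: in the product with the ratio the deltas at [l.+1] cancel. *)
Lemma sweeps_bracket r : (r <= n)%N ->
  standard_bracket br (n - r) n (Y r) /\
  forall k l p j, (k < n - r)%N -> (n - r <= p < n)%N -> (l < n)%N -> (j < n)%N ->
    br (Y r k l) (t p j) = (l == j)%:R * (Y r k l * t p j).
Proof.
elim: r => [|r IH] rn.
  by rewrite subn0; split=> // k l p j _ /andP[np pn]; move: pn; rewrite ltnNge np.
have [Ystd Yt] := IH (ltnW rn).
have rm : (n - r = (n - r.+1).+1)%N by lia.
rewrite rm in Ystd Yt; set m := (n - r.+1)%N in Ystd Yt *.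
have mn : (m < n)%N by lia.
have tm : t m = Y r m by rewrite /t /torus; congr (sweeps _ _ _ _); lia.
have Y0 l : (l < n)%N -> Y r m l != 0 by rewrite -tm; apply: torus_neq0.
split=> [|k l p j km /andP[mp pn] ln jn]; first exact: sweep_standard.
have [mp'|mp'] := leqP m.+1 p; last first.
  have -> : p = m by lia.
  by rewrite tm; apply: sweep_last_row Ystd Y0 _ _ _ km ln jn.
rewrite /Y /= -/Y -/m /sweep.
have Dt := br_der brK (t p j).
rewrite (derivationB Dt) (derivationM Dt) Yt ?(leqW km) ?mp' //.
rewrite /next_ratio; case: ifP => lSn; last by rewrite (derivation0 Dt); ring.
rewrite Yt ?(leqW km) ?mp' //.
rewrite (derivationM Dt) (derivationV Dt) ?Y0 // !Yt ?mp' //.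
have Yl := Y0 _ lSn; field; exact: Yl.
Qed.

Definition torus_weight (k l p q : nat) : int :=
  sg k p * (l == q)%:R + (k == p)%:R * sg l q.

(** For [k < p], row [k] is still active when row [p] is already a pivot row. Within one row the
    standard bracket is itself log-canonical. *)
Lemma torus_bracket k l p q :
  (k < n)%N -> (l < n)%N -> (p < n)%N -> (q < n)%N ->
  br (t k l) (t p q) = (torus_weight k l p q)%:~R * (t k l * t p q).
Proof.
have lt_case k' l' p' q' : (k' < p')%N -> (l' < n)%N -> (p' < n)%N -> (q' < n)%N ->
    br (t k' l') (t p' q') = (torus_weight k' l' p' q')%:~R * (t k' l' * t p' q').
  move=> kp ln pn qn; have [_] := @sweeps_bracket (n - k'.+1) (leq_subr _ _).
  rewrite /torus_weight sg_lt // (ltn_eqF kp) mul0r addr0 mul1r.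
  by move=> /(_ k' l' p' q') -> //; [case: (l' == q')|lia|lia].
move=> kn ln pn qn; case: (ltngtP k p) => kp; first exact: lt_case.
  rewrite (brC brK) lt_case // /torus_weight (sgC k p) (sgC l q).
  rewrite (eq_sym k) (eq_sym l) [t k l * _]mulrC -mulNr -rmorphN; congr (_%:~R * _).
  ring.
subst p; have [+ _] := @sweeps_bracket (n - k.+1) (leq_subr _ _).
rewrite /torus_weight eqxx sgxx mul0r add0r mul1r => Ystd.
by rewrite Ystd ?sgxx ?add0r ?[t k l * _]mulrC //; lia.
Qed.

End TorusBracket.

(** * The commutant of the sign matrix *)

(** The row vector [f] times the sign matrix S. On a column of [v], skewness of S makes it minus the
    product from the left, so [v_ker] below says that [v] commutes with S. *)
Definition sgsum (n : nat) (f : nat -> int) (i : nat) : int :=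
  \sum_(k < n) f k * sg k i.

(** Neighbouring columns of the sign matrix differ, by 1, in rows [i] and [i.+1] only. *)
Lemma sgsumS n f i : (i.+1 < n)%N -> sgsum n f i.+1 - sgsum n f i = f i + f i.+1.
Proof.
move=> iSn; have iN := ltnW iSn; rewrite /sgsum -sumrB.
have E k : f k * sg k i.+1 - f k * sg k i =
    f k * (k == i)%:R + f k * (k == i.+1)%:R.
  rewrite -mulrBr -mulrDr; congr (_ * _).
  case: (ltngtP k i) => ki.
  - by rewrite (sg_lt ki) sg_lt ?leqW // (_ : (k == i.+1) = false); last lia.
  - case: (ltngtP k i.+1) => ki'; first lia.
      by rewrite !sg_gt.
    by rewrite ki' sgxx sg_gt.
  - by rewrite ki sgxx sg_lt //; have -> : (i == i.+1) = false by lia.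
under eq_bigr do rewrite E.
by rewrite big_split /= !sum_delta iSn iN.
Qed.

(** The first and last columns of the sign matrix cancel outside the two extreme rows. *)
Lemma sgsum_ends n f : sgsum n.+1 f 0 + sgsum n.+1 f n = f 0%N - f n.
Proof.
rewrite /sgsum -big_split /=.
have E k : (k <= n)%N ->
    f k * sg k 0 + f k * sg k n = f k * (k == 0)%:R - f k * (k == n)%:R.
  rewrite -mulrBr -mulrDr leq_eqVlt => /orP[/eqP->|kn]; congr (_ * _).
    by rewrite eqxx sgxx addr0; case: n => // m; rewrite sg_gt.
  by rewrite (sg_lt kn) (ltn_eqF kn) subr0; case: k kn => // k _; rewrite sg_gt.
under eq_bigr => k _ do rewrite (E k (ltn_ord k)).
by rewrite sumrB !(sum_delta n.+1 f) ltnS leqnn.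
Qed.

Section Kernel.
Variables (n : nat) (v : nat -> nat -> int).
Hypothesis v_ker : forall i j, (i <= n)%N -> (j <= n)%N ->
  sgsum n.+1 (v^~ j) i + sgsum n.+1 (v i) j = 0.

(** The kernel equations at the corners of a unit square, with [sgsumS] along its four sides, form a
    linear system that implies this. *)
Lemma ker_toeplitz i j : (i < n)%N -> (j < n)%N -> v i.+1 j.+1 = v i j.
Proof.
move=> iN jn.
have := v_ker (ltnW iN) (ltnW jn); have := v_ker iN (ltnW jn).
have := v_ker (ltnW iN) jn; have := v_ker iN jn.
have := @sgsumS n.+1 (v^~ j) i iN; have := @sgsumS n.+1 (v^~ j.+1) i iN.
have := @sgsumS n.+1 (v i) j jn; have := @sgsumS n.+1 (v i.+1) j jn.
by lia.
Qed.

(** The same square across the border from row [n] to row 0, with [sgsum_ends] on two of its sides;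
    this produces the sign. *)
Lemma ker_corner j : (j < n)%N -> v n j = - v 0%N j.+1.
Proof.
move=> jn.
have := v_ker (leq0n n) (ltnW jn); have := v_ker (leqnn n) (ltnW jn).
have := v_ker (leq0n n) jn; have := v_ker (leqnn n) jn.
have := sgsum_ends n (v^~ j); have := sgsum_ends n (v^~ j.+1).
have := @sgsumS n.+1 (v 0%N) j jn; have := @sgsumS n.+1 (v n) j jn.
by lia.
Qed.

Lemma ker_negacyclic i j : (i <= n)%N -> (j <= n)%N ->
  v i j = if (i <= j)%N then v 0%N (j - i)%N else - v 0%N (n.+1 + j - i)%N.
Proof.
have shift a i' j' : (i' + a <= n)%N -> (j' + a <= n)%N ->
    v (i' + a)%N (j' + a)%N = v i' j'.
  elim: a => [|a IH] ia ja; first by rewrite !addn0.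
  by rewrite !addnS ker_toeplitz ?IH //; lia.
move=> iN jn; case: leqP => ij.
  rewrite -{1}(add0n i) -{1}(subnK ij); apply: shift; lia.
(* An entry below the diagonal is moved along its diagonal to row [n], from where it crosses to row
   0. *)
rewrite -(shift (n - i)%N) ?subnKC //; last lia.
by rewrite ker_corner; [congr (- v _ _); lia|lia].
Qed.
End Kernel.

(* The entries of the d-th power of the negacyclic shift, for d < n. *)
Definition negashift (n d i j : nat) : int :=
  (j == i + d)%N%:R - (i == j + (n - d))%N%:R.

(** Each position lies on the support of exactly one power, so the first row of [v] gives the
    coefficients. *)
Lemma ker_negashift n v : (forall i j, (i <= n)%N -> (j <= n)%N ->
    sgsum n.+1 (v^~ j) i + sgsum n.+1 (v i) j = 0) ->
  forall i j, (i <= n)%N -> (j <= n)%N ->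
  v i j = \sum_(d < n.+1) v 0%N d * negashift n.+1 d i j.
Proof.
move=> v_ker i j iN jn; rewrite (ker_negacyclic v_ker) //.
have [ij|ji] := leqP i j.
  rewrite (@sum_delta_lt _ n.+1 (v 0%N)); last by lia.
  apply: eq_bigr => d _; have := ltn_ord d => dn.
  rewrite /negashift; have -> : (i == j + (n.+1 - d))%N = false by lia.
  by rewrite subr0; congr (_ * _%:R); lia.
rewrite (@sum_delta_lt _ n.+1 (v 0%N)); last by lia.
rewrite -sumrN; apply: eq_bigr => d _; have := ltn_ord d => dn.
rewrite /negashift; have -> : (j == i + d)%N = false by lia.
by rewrite sub0r mulrN; congr (- (_ * _%:R)); lia.
Qed.

(** Each row and column of the power has one nonzero entry, so both sums are single signs. They are
    opposite by skewness if neither or both wrap around; in the mixed cases the bounds fix each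
    sign. *)
Lemma negashift_ker n d i j : (d < n)%N -> (i < n)%N -> (j < n)%N ->
  sgsum n ((negashift n d)^~ j) i + sgsum n (negashift n d i) j = 0.
Proof.
move=> dn iN jn; rewrite /sgsum.
have -> : \sum_(k < n) negashift n d k j * sg k i =
    if (d <= j)%N then sg (j - d) i else - sg (j + (n - d)) i.
  have [dj|jd] := leqP d j.
    rewrite (@sum_delta_lt _ n (sg^~ i)); last by lia.
    apply: eq_bigr => k _; have kn := ltn_ord k.
    rewrite /negashift mulrC; have -> : (k == j + (n - d) :> nat)%N = false by lia.
    by rewrite subr0; congr (_ * _%:R); lia.
  rewrite (@sum_delta_lt _ n (sg^~ i)); last by lia.
  rewrite -sumrN; apply: eq_bigr => k _; have kn := ltn_ord k.
  rewrite /negashift mulrC; have -> : (j == k + d)%N = false by lia.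
  by rewrite sub0r mulrN.
have -> : \sum_(k < n) negashift n d i k * sg k j =
    if (i + d < n)%N then sg (i + d) j else - sg (i + d - n) j.
  have [dj|jd] := ltnP (i + d) n.
    rewrite (@sum_delta_lt _ n (sg^~ j)); last by lia.
    apply: eq_bigr => k _; have kn := ltn_ord k.
    rewrite /negashift mulrC; have -> : (i == k + (n - d))%N = false by lia.
    by rewrite subr0; congr (_ * _%:R); lia.
  rewrite (@sum_delta_lt _ n (sg^~ j)); last by lia.
  rewrite -sumrN; apply: eq_bigr => k _; have kn := ltn_ord k.
  rewrite /negashift mulrC; have -> : (k == i + d :> nat)%N = false by lia.
  by rewrite sub0r mulrN; congr (- (_ * _%:R)); lia.
have [dj|jd] := leqP d j; have [idn|nid] := ltnP (i + d) n.
- rewrite -[sg (i + d) j]opprK -sgC; apply/eqP; rewrite subr_eq0 /sg; apply/eqP.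
  by congr sgz; lia.
- by rewrite sg_lt ?sg_lt ?subrr //; lia.
- by rewrite sg_gt ?sg_gt ?subrr //; lia.
- rewrite sgC -[sg (i + d - n) j]opprK -[- sg (i + d - n) j]sgC !opprK.
  by rewrite sgC addrC; apply/eqP; rewrite subr_eq0 /sg; apply/eqP; congr sgz; lia.
Qed.

(** * The center of a log-canonical field *)

Lemma prod_delta (V : comNzRingType) (s : nat) (f : nat -> V) (j : nat) :
  \prod_(k < s) f k ^+ (k == j :> nat) = if (j < s)%N then f j else 1.
Proof.
case: ifP => js.
  rewrite (bigD1 (Ordinal js)) //= eqxx expr1 big1 ?mulr1 // => k.
  by rewrite -val_eqE /= => /negPf ->.
rewrite big1 // => k _; have -> : (k == j :> nat) = false; last exact: expr0.
by apply: contraFF js => /eqP <-.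
Qed.

Lemma prod_shifted_diagonal (V : comNzRingType) (n d : nat) (f : nat -> nat -> V) :
  \prod_(i < n) \prod_(j < n) f i j ^+ (j == i + d :> nat)%N =
  \prod_(i < n - d) f i (i + d)%N.
Proof.
rewrite (big_ord_widen n (fun i => f i (i + d)%N)) ?leq_subr // [RHS]big_mkcond.
by apply: eq_bigr => i _; rewrite (prod_delta n (f i)) ltn_subRL addnC.
Qed.

Section Monomials.
Variables (K : fieldType) (n : nat) (t : nat -> nat -> K).
Hypothesis t_neq0 : forall k l, (k < n)%N -> (l < n)%N -> t k l != 0.

Definition monomial (V : 'M[int]_n) : K := \prod_(i < n) \prod_(j < n) t i j ^ V i j.

Lemma t_ord_neq0 (i j : 'I_n) : t i j != 0. Proof. exact: t_neq0. Qed.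

Lemma monomialD V W : monomial (V + W) = monomial V * monomial W.
Proof.
rewrite /monomial -big_split /=; apply: eq_bigr => i _.
rewrite -big_split /=; apply: eq_bigr => j _.
by rewrite mxE expfzDr // t_ord_neq0.
Qed.

Lemma monomial0 : monomial 0 = 1.
Proof. by rewrite /monomial big1 // => i _; rewrite big1 // => j _; rewrite mxE. Qed.

Lemma monomial_neq0 V : monomial V != 0.
Proof.
apply/prodf_neq0 => i _; apply/prodf_neq0 => j _.
by rewrite expfz_neq0 // t_ord_neq0.
Qed.

Lemma monomialB V W : monomial (V - W) = monomial V / monomial W.
Proof.
apply: (mulIf (monomial_neq0 W)).
by rewrite -monomialD divfK ?subrK ?monomial_neq0.
Qed.

Lemma monomialZ c V : monomial (c *: V) = monomial V ^ c.
Proof.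
have expc := big_morph (fun x : K => x ^ c) (fun x y => expfzMl x y c) (exp1rz _ c).
rewrite /monomial [RHS]expc.
apply: eq_bigr => i _.
rewrite [RHS]expc.
by apply: eq_bigr => j _; rewrite mxE mulrC exprz_exp.
Qed.

Lemma monomial_delta (k l : 'I_n) : monomial (delta_mx k l) = t k l.
Proof.
rewrite /monomial (bigD1 k) //= [X in _ * X]big1 ?mulr1; last first.
  by move=> i /negPf ik; rewrite big1 // => j _; rewrite mxE ik.
rewrite (bigD1 l) //= mxE !eqxx big1 ?mulr1 // => j /negPf jl.
by rewrite mxE jl andbF.
Qed.

Definition negashift_mx (d : nat) : 'M[int]_n := \matrix_(i, j) negashift n d i j.

Lemma monomial_negashift d : (d <= n)%N ->
  monomial (negashift_mx d) =
    (\prod_(i < n - d) t i (i + d)%N) / \prod_(j < d) t (j + (n - d))%N j.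
Proof.
move=> dn; rewrite -(prod_shifted_diagonal n d t).
(* Exchanging the indices makes the lower diagonal an upper one with shift [n - d]. *)
have := prod_shifted_diagonal n (n - d) (fun j i => t i j).
rewrite subKn // => <-; rewrite [X in _ / X]exchange_big /= -prodf_div.
apply: eq_bigr => i _.
rewrite -prodf_div; apply: eq_bigr => j _; rewrite mxE /negashift.
by rewrite expfzDr ?t_ord_neq0 // -invr_expz !natz.
Qed.
End Monomials.

Section LogCanonicalCenter.
Variables (K : fieldType) (br : K -> K -> K).
Variables (C : comNzRingType) (cst : {rmorphism C -> K}).
Variables (n : nat) (t : nat -> nat -> K).
Hypothesis brK : biderivation br.
Hypothesis br_cst : forall c g, br (cst c) g = 0.
Hypothesis int_inj : forall z : int, (z%:~R == 0 :> K) = (z == 0).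
Hypothesis t_neq0 : forall k l, (k < n)%N -> (l < n)%N -> t k l != 0.
Hypothesis br_t : forall k l p q, (k < n)%N -> (l < n)%N -> (p < n)%N -> (q < n)%N ->
  br (t k l) (t p q) = (torus_weight k l p q)%:~R * (t k l * t p q).
Hypothesis t_gen : forall G : K -> Prop, subfield G -> (forall c, G (cst c)) ->
  (forall k l, (k < n)%N -> (l < n)%N -> G (t k l)) -> forall f, G f.

Notation mon := (monomial t).
Implicit Types V W : 'M[int]_n.

Definition weight V : 'M[int]_n :=
  \matrix_(p, q) \sum_(k < n) \sum_(l < n) V k l * torus_weight k l p q.

Lemma weightB V W : weight (V - W) = weight V - weight W.
Proof.
apply/matrixP => p q; rewrite !mxE -sumrB; apply: eq_bigr => k _.
by rewrite -sumrB; apply: eq_bigr => l _; rewrite !mxE mulrBl.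
Qed.

(** Division by the coordinate makes every monomial an eigenvector. *)
Definition log_bracket (a : 'I_n * 'I_n) (f : K) : K := br f (t a.1 a.2) / t a.1 a.2.

Lemma log_bracket_der a : derivation (log_bracket a).
Proof.
have D := br_der brK (t a.1 a.2).
by split=> f g; rewrite /log_bracket ?(derivationD D) ?(derivationM D); ring.
Qed.

Lemma log_bracket_monomial a V :
  log_bracket a (mon V) = (weight V a.1 a.2)%:~R * mon V.
Proof.
have DD := log_bracket_der a.
rewrite mxE rmorph_sum; apply: (deriv_weight_prod DD) => k.
rewrite rmorph_sum; apply: (deriv_weight_prod DD) => l.
rewrite rmorphM; apply: (deriv_weightXz DD); first exact: t_ord_neq0.
by rewrite /log_bracket br_t // mulrA mulfK ?t_ord_neq0.
Qed.

Lemma log_bracket_cst a c : log_bracket a (cst c) = 0.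
Proof. by rewrite /log_bracket br_cst mul0r. Qed.

(** A Laurent polynomial is a list of terms, possibly with repeated exponents; only its value in [K]
    is compared. *)
Definition laurent (s : seq (C * 'M[int]_n)) : K := \sum_(x <- s) cst x.1 * mon x.2.

Lemma laurent_cat s1 s2 : laurent (s1 ++ s2) = laurent s1 + laurent s2.
Proof. exact: big_cat. Qed.

Lemma laurentN s : exists s', laurent s' = - laurent s.
Proof.
exists [seq (- x.1, x.2) | x <- s]; rewrite /laurent big_map -sumrN.
by apply: eq_bigr => x _; rewrite rmorphN mulNr.
Qed.

Lemma laurentM s1 s2 : exists s, laurent s = laurent s1 * laurent s2.
Proof.
exists [seq (x.1 * y.1, x.2 + y.2) | x <- s1, y <- s2].
rewrite /laurent big_allpairs_dep mulr_suml; apply: eq_bigr => x _.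
rewrite mulr_sumr; apply: eq_bigr => y _.
by rewrite rmorphM /= (monomialD t_neq0) mulrACA.
Qed.

Definition laurent_quotient (f : K) : Prop :=
  exists s1 s2, laurent s2 != 0 /\ f = laurent s1 / laurent s2.

Lemma laurent_cst c : laurent [:: (c, 0)] = cst c.
Proof. by rewrite /laurent big_seq1 monomial0 mulr1. Qed.

(** Such quotients form a subfield containing the constants and the [t k l], so [t_gen] applies. *)
Lemma laurent_quotientT f : laurent_quotient f.
Proof.
have one : laurent [:: (1, 0)] = 1 by rewrite laurent_cst rmorph1.
have emb s : laurent_quotient (laurent s).
  by exists s, [:: (1, 0)]; rewrite one oner_neq0 divr1.
apply: t_gen => [|c|k l kn ln]; last 2 first.
- by rewrite -laurent_cst; apply: emb.
- have -> : t k l = laurent [:: (1, delta_mx (Ordinal kn) (Ordinal ln))];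
    last exact: emb.
  by rewrite /laurent big_seq1 rmorph1 mul1r monomial_delta.
split=> [|f1 f2 [p1 [q1 [q10 ->]]] [p2 [q2 [q20 ->]]]
         |f1 f2 [p1 [q1 [q10 ->]]] [p2 [q2 [q20 ->]]]].
- by rewrite -one; apply: emb.
- have [r1 r1E] := laurentM p1 q2; have [r2 r2E] := laurentM p2 q1.
  have [r2' r2'E] := laurentN r2; have [r3 r3E] := laurentM q1 q2.
  exists (r1 ++ r2'), r3; rewrite laurent_cat r1E r2'E r2E r3E mulf_neq0 //.
  split=> //.
  by field; rewrite q20.
have [r1 r1E] := laurentM p1 q2; have [r2 r2E] := laurentM q1 p2.
(* Division by 0 gives 0 by convention, which is again a quotient. *)
have [->|p20] := eqVneq (laurent p2) 0.
  exists [::], [:: (1, 0)]; rewrite one oner_neq0; split=> //.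
  by rewrite /laurent big_nil mul0r invr0 mulr0 mul0r.
exists r1, r2; rewrite r1E r2E mulf_neq0 //; split=> //.
by field; rewrite ?q10 ?q20 ?p20.
Qed.

(** Identifies the weight with the commutator expression of [v_ker]. *)
Lemma weightE V (v : nat -> nat -> int) (p q : 'I_n) :
  (forall i j : 'I_n, V i j = v i j) ->
  weight V p q = sgsum n (v^~ q) p + sgsum n (v p) q.
Proof.
move=> Vv; rewrite mxE /sgsum.
have -> : \sum_(k < n) v k q * sg k p =
    \sum_(k < n) \sum_(l < n) v k l * (sg k p * (l == q)%:R).
  apply: eq_bigr => k _; under [RHS]eq_bigr do rewrite mulrCA.
  by rewrite -mulr_sumr (sum_delta n (v k)) ltn_ord mulrC.
have -> : \sum_(l < n) v p l * sg l q =
    \sum_(k < n) \sum_(l < n) v k l * ((k == p)%:R * sg l q).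
  rewrite exchange_big; apply: eq_bigr => l _; under [RHS]eq_bigr do rewrite mulrA.
  by rewrite -mulr_suml (sum_delta n (v^~ l)) ltn_ord.
rewrite -big_split /=; apply: eq_bigr => k _; rewrite -big_split /=.
by apply: eq_bigr => l _; rewrite Vv -mulrDr.
Qed.

Lemma weight_negashift d : (d < n)%N -> weight (negashift_mx n d) = 0.
Proof.
move=> dn; apply/matrixP => p q; rewrite (@weightE _ (negashift n d)) => [|i j].
  by rewrite negashift_ker ?ltn_ord // mxE.
by rewrite mxE.
Qed.

Lemma weight0_negashift V : weight V = 0 ->
  exists c : nat -> int, V = \sum_(d < n) c d *: negashift_mx n d.
Proof.
(* [v] extends [V] by 0 to natural indices. *)
move=> V0; pose v i j := if insub i is Some i' then
  if insub j is Some j' then V i' j' else 0 else 0.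
have vE (i j : 'I_n) : V i j = v i j by rewrite /v !valK.
have v_ker p q : (p < n)%N -> (q < n)%N -> sgsum n (v^~ q) p + sgsum n (v p) q = 0.
  by move=> pn qn; rewrite -(weightE (Ordinal pn) (Ordinal qn) vE) V0 mxE.
have v_sum p q : (p < n)%N -> (q < n)%N ->
    v p q = \sum_(d < n) v 0%N d * negashift n d p q.
  by move: (n) v_ker => [|m] // v_ker pn qn; apply: (ker_negashift v_ker).
exists (v 0%N); apply/matrixP => i j; rewrite summxE vE v_sum //.
by apply: eq_bigr => d _; rewrite !mxE.
Qed.

Lemma log_canonical_center f :
  (forall g, br f g = 0) <->
  (forall G : K -> Prop, subfield G -> (forall c, G (cst c)) ->
    (forall d, (d < n)%N -> G (mon (negashift_mx n d))) -> G f).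
Proof.
split=> [f_central G GK Gc Gt|f_gen]; last first.
  (* The center is a subfield containing the constants; a monomial of weight 0 is central because it
     commutes with all generators. *)
  apply: (f_gen (fun h => forall g, br h g = 0)).
  - by split=> [g|f1 f2 c1 c2 g|f1 f2 c1 c2 g];
      case: (subfield_deriv_ker (br_der brK g)) => // ? ? ?; auto.
  - exact: br_cst.
  - move=> d dn; apply: t_gen => [|c|k l kn ln].
    + exact: (subfield_deriv_ker (br_derr brK _)).
    + by rewrite (brC brK) br_cst oppr0.
    + have := log_bracket_monomial (Ordinal kn, Ordinal ln) (negashift_mx n d).
      rewrite weight_negashift // mxE mul0r /log_bracket /=.
      by move/eqP; rewrite mulf_eq0 invr_eq0 (negPf (t_neq0 kn ln)) orbF => /eqP.
have [p [q [q0 fE]]] := laurent_quotientT f.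
pose h (x : bool * (C * 'M[int]_n)) :=
  (if x.1 then f else -1) * (cst x.2.1 * mon x.2.2).
(* The family h over s lists the terms of f * q - p = 0. *)
pose s := [seq (true, x) | x <- q] ++ [seq (false, x) | x <- p].
pose part W r := \sum_(x <- r | weight x.2 == W) cst x.1 * mon x.2.
(* As [f] is central, a factor [f] leaves the weight of a term unchanged. *)
have Dh x a : log_bracket a (h x) = (weight x.2.2 a.1 a.2)%:~R * h x.
  have DD := log_bracket_der a.
  rewrite /h !(derivationM DD) log_bracket_cst log_bracket_monomial.
  have -> : log_bracket a (if x.1 then f else -1) = 0.
    case: ifP => _; first by rewrite /log_bracket f_central mul0r.
    by rewrite (derivationN DD) (derivation1 DD) oppr0.
  ring.
have hs : \sum_(x <- s) h x = 0.
  rewrite big_cat /= !big_map -!mulr_sumr -/(laurent _) -/(laurent _).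
  by rewrite fE divfK // mulN1r subrr.
have pq W : f * part W q = part W p.
  have := @weight_component0 _ _ log_bracket _
    (fun W a => (W a.1 a.2)%:~R) _ (fun x => weight x.2.2)
    log_bracket_der _ _ s h W Dh hs.
  rewrite big_cat /= !big_map -!mulr_sumr => /(_ _ _)/eqP.
  rewrite mulN1r subr_eq0 => pqE.
  apply/eqP; apply: pqE.
  - by move=> V a b; apply: (subfield_int (subfield_deriv_ker (log_bracket_der b))).
  (* Distinct integer weights remain distinct in [K] by [int_inj]. *)
  - move=> V V' VV'; apply/existsP; apply: contraNT VV'.
    rewrite negb_exists => /forallP VV'.
    apply/eqP/matrixP => i j; have := VV' (i, j).
    by rewrite negbK -subr_eq0 -rmorphB int_inj subr_eq0 => /eqP.
(* A nonzero denominator has a nonzero component, at the weight of one of its terms. *)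
have [x0 _ qW] : exists2 x0, x0 \in q & part (weight x0.2) q != 0.
  apply/hasP; apply: contraNT q0 => /hasPn q0.
  apply/eqP; apply: (@sum_weight_components _ _ _ (fun x => weight x.2)) => W.
  have [/hasP[x xq /eqP <-]|] := boolP (has (fun x => weight x.2 == W) q);
    last exact: big_hasC.
  by have := q0 x xq; rewrite negbK => /eqP.
set W := weight x0.2 in qW.
have part_in r : G (part W r / mon x0.2).
  rewrite /part mulr_suml; apply: subfield_sum => // x /eqP xW.
  rewrite -mulrA -(monomialB t_neq0); apply: subfieldM => //.
  have [c ->] : exists c : nat -> int,
      x.2 - x0.2 = \sum_(d < n) c d *: negashift_mx n d.
    by apply: weight0_negashift; rewrite weightB xW subrr.
  rewrite (big_morph _ (monomialD t_neq0) (monomial0 _ _)).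
  apply: subfield_prod => // d _; rewrite monomialZ; apply: subfield_exprz => //.
  exact: Gt.
have -> : f = (part W p / mon x0.2) / (part W q / mon x0.2).
  by rewrite -pq; field; rewrite qW (monomial_neq0 t_neq0).
exact: subfield_div.
Qed.
End LogCanonicalCenter.

(** * Rational functions on matrices *)

Section RationalFunctions.
Variables (R : realType) (n : nat).
Local Notation P := (matpoly R n).
Local Notation K := (ratfun R n).
Local Notation "p %:F" := (@FracField.tofrac P p).

Lemma ratfun_quotient (f : K) : exists p q : P, q != 0 /\ f = p%:F / q%:F.
Proof.
exists \n_(repr f), \d_(repr f); split; first exact: denom_ratioP.
by rewrite -ratfunE reprK.
Qed.


Lemma pdiff_der (i j : 'I_n) : derivation (@pdiff R n i j).
Proof.
apply: (@quotient_derivation _ _ (@FracField.tofrac P) (mderiv (mxvec_index i j))).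
- exact: mderivD.
- exact: mderivM.
- move=> f; have [p [q [q0 fE]]] := ratfun_quotient f.
  by exists p, q; rewrite tofrac_eq0.
move=> p q; rewrite tofrac_eq0 => q0; rewrite pdiffE // /quotient_rule.
by rewrite tofracXn rmorphB !rmorphM.
Qed.

Lemma pdiff_const (i j : 'I_n) (c : complex R) : pdiff i j (ratfun_const n c) = 0.
Proof.
rewrite /ratfun_const -[_%:F]divr1 -tofrac1 pdiffE ?oner_eq0 // /quotient_rule.
by rewrite -mpolyC1 !mderivC mulr0 mul0r subrr tofrac0 mul0r.
Qed.

Lemma poisson_biderivation : biderivation (@poisson R n).
Proof.
split=> [g|f g].
  split=> f h; rewrite /poisson.
    rewrite -big_split; apply: eq_bigr => i _.
    rewrite -big_split; apply: eq_bigr => j _.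
    rewrite -big_split; apply: eq_bigr => k _.
    rewrite -big_split; apply: eq_bigr => l _.
    by rewrite /= (derivationD (pdiff_der i j)) mulrDl mulrDr.
  rewrite mulr_suml mulr_sumr -big_split; apply: eq_bigr => i _.
  rewrite mulr_suml mulr_sumr -big_split; apply: eq_bigr => j _.
  rewrite mulr_suml mulr_sumr -big_split; apply: eq_bigr => k _.
  rewrite mulr_suml mulr_sumr -big_split; apply: eq_bigr => l _.
  rewrite /= (derivationM (pdiff_der i j)).
  move: (_%:~R * _) (pdiff i j f) (pdiff i j h) (pdiff k l g) => *; ring.
have swap4 (F : 'I_n -> 'I_n -> 'I_n -> 'I_n -> K) :
    \sum_i \sum_j \sum_k \sum_l F i j k l = \sum_i \sum_j \sum_k \sum_l F k l i j.
  under eq_bigr do rewrite exchange_big; rewrite exchange_big; apply: eq_bigr => k _.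
  by under eq_bigr do rewrite exchange_big; rewrite exchange_big.
rewrite [X in - X]swap4 -sumrN; apply: eq_bigr => i _.
rewrite -sumrN; apply: eq_bigr => j _; rewrite -sumrN; apply: eq_bigr => k _.
rewrite -sumrN; apply: eq_bigr => l _.
rewrite -[_%:Z - k%:Z]opprB sgzN -[_%:Z - l%:Z]opprB sgzN -opprD rmorphN /=.
move: (_%:~R) (coordmx R n i l) (coordmx R n k j) (pdiff i j f) (pdiff k l g).
by move=> *; ring.
Qed.

Lemma poisson_const (c : complex R) (g : K) : poisson (ratfun_const n c) g = 0.
Proof.
rewrite /poisson big1 // => i _; rewrite big1 // => j _; rewrite big1 // => k _.
by rewrite big1 // => l _; rewrite pdiff_const mul0r mulr0.
Qed.

Lemma subfield_ratfun (G : K -> Prop) : subfield G ->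
  (forall c, G (ratfun_const n c)) -> (forall i j, G (coordmx R n i j)) ->
  forall f, G f.
Proof.
move=> GK Gc GX.
have GP p : G p%:F.
  rewrite (mpolyE p) rmorph_sum; apply: subfield_sum => // m _.
  rewrite -mul_mpolyC rmorphM; apply: subfieldM => //; first exact: Gc.
  rewrite mpolyXE_id rmorph_prod; apply: subfield_prod => // k _.
  rewrite rmorphXn; apply: subfieldX => //.
  by case/mxvec_indexP: k => i j; have := GX i j; rewrite mxE.
by move=> f; have [p [q [_ ->]]] := ratfun_quotient f; apply: subfield_div.
Qed.

Lemma ratfun_int_eq0 (z : int) : (z%:~R == 0 :> K) = (z == 0).
Proof.
rewrite -(rmorph_int (@FracField.tofrac P)) tofrac_eq0.
by rewrite -(rmorph_int (@mpolyC (n * n) _)) mpolyC_eq0 intr_eq0.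
Qed.
End RationalFunctions.

(** Bounds of [interval] count from 1 and ordinals from 0, hence [a.+1]. Two strictly increasing
    lists with the same members are equal. *)
Lemma enum_interval n a s : (a + s <= n)%N ->
  map val (enum (Defs.interval n a.+1 (a + s))) = iota a s.
Proof.
move=> asn; apply: (irr_sorted_eq ltn_trans ltnn) => [||i].
- rewrite sorted_map; apply: sorted_filter.
    by move=> x y z; apply: ltn_trans.
  by rewrite -enumT -sorted_map val_enum_ord iota_ltn_sorted.
- exact: iota_ltn_sorted.
rewrite mem_iota; apply/mapP/idP => [[j + ->]|ai]; rewrite ?mem_enum ?inE //.
have iN : (i < n)%N by lia.
by exists (Ordinal iN); rewrite // mem_enum inE.
Qed.

(** * Corner minors as monomials in the pivots *)

Section Coordinates.
Variables (R : realType) (n : nat).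
Local Notation K := (ratfun R n.+1).

Definition coord (i j : nat) : K := coordmx R n.+1 (inord i) (inord j).

Lemma coord_std : standard_bracket (@poisson R n.+1) n.+1 n.+1 coord.
Proof. by move=> k l p q kn pn ln qn; rewrite poisson_coord !inordK. Qed.

Lemma pdiff_coord_inord k l p q :
  (k < n.+1)%N -> (l < n.+1)%N -> (p < n.+1)%N -> (q < n.+1)%N ->
  pdiff (inord k) (inord l) (coord p q) = ((k == p) && (l == q))%:R.
Proof. by move=> kn ln pn qn; rewrite pdiff_coord -!val_eqE /= !inordK. Qed.

Lemma minor_solid a b s : (a + s <= n.+1)%N -> (b + s <= n.+1)%N ->
  minor R (Defs.interval n.+1 a.+1 (a + s)) (Defs.interval n.+1 b.+1 (b + s)) =
    solid coord a b s.
Proof.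
move=> an bn; rewrite /minor.
set I := Defs.interval _ _ _; set J := Defs.interval _ _ _.
have IE := enum_interval an; have JE := enum_interval bn; rewrite -/I -/J in IE JE.
have cI : #|I| = s by rewrite cardE -(size_map val) IE size_iota.
(* The size occurs in the type of the matrix, so it stays [#|I|] while the entries are compared. *)
have -> : \det (\matrix_(i < #|I|, j < #|I|)
      coordmx R n.+1 (enum_val i) (nth (enum_val i) (enum J) j)) =
    solid coord a b #|I|; last by rewrite cI.
congr (\det _); apply/matrixP => i j; rewrite !mxE.
have is_ : (i < s)%N by rewrite -cI. have js : (j < s)%N by rewrite -cI.
have sI : size (enum I) = s by rewrite -cardE.
have sJ : size (enum J) = s by rewrite -(size_map val) JE size_iota.
have eI : enum_val i = (a + i)%N :> nat.
  by rewrite /enum_val -(nth_map _ 0%N val) ?sI // IE nth_iota.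
have eJ : nth (enum_val i) (enum J) j = (b + j)%N :> nat.
  by rewrite -(nth_map _ 0%N val) ?sJ // JE nth_iota.
by rewrite /coord -eI -eJ !inord_val mxE.
Qed.

Local Notation t := (torus n.+1 coord).

Lemma torus_coord_neq0 k l : (k < n.+1)%N -> (l < n.+1)%N -> t k l != 0.
Proof.
apply: (@torus_neq0 _ (fun k l => pdiff (inord k) (inord l)) n.+1) => [? ? _ _|].
  exact: pdiff_der.
exact: pdiff_coord_inord.
Qed.

Lemma monomial_negashift_det :
  monomial t (negashift_mx n.+1 0) = \det (coordmx R n.+1).
Proof.
rewrite (monomial_negashift torus_coord_neq0) // subn0 big_ord0 divr1.
transitivity (solid coord 0 0 n.+1).
  rewrite (solid_bottom torus_coord_neq0) //.
  by apply: eq_bigr => i _; rewrite addn0.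
congr (\det _); apply/matrixP => i j.
by rewrite /coord mxE !inord_val.
Qed.

(** For the shift [n.+1 - k], the upper diagonal has length [k] and gives the upper-right minor; the
    lower one has length [n.+1 - k] and gives the lower-left minor. *)
Lemma monomial_negashift_minors k : (1 <= k <= n)%N ->
  monomial t (negashift_mx n.+1 (n.+1 - k)) =
    upper_right_minor R n.+1 k / lower_left_minor R n.+1 (n.+1 - k).
Proof.
case/andP=> k0 kn; have kN := leqW kn.
rewrite (monomial_negashift torus_coord_neq0) ?leq_subr // subKn //.
have -> : upper_right_minor R n.+1 k = \prod_(i < k) t i (n.+1 - k + i)%N.
  rewrite -(@solid_right _ _ _ torus_coord_neq0 (n.+1 - k) k) ?subnK //.
  rewrite -minor_solid ?subnK //.
  by rewrite /upper_right_minor addn1.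
have -> : lower_left_minor R n.+1 (n.+1 - k) = \prod_(i < n.+1 - k) t (k + i)%N i.
  rewrite -(solid_bottom torus_coord_neq0 (b := 0)) ?subnKC ?leq_subr //.
  by rewrite -minor_solid ?subnKC ?leq_subr // /lower_left_minor subKn // addn1.
by congr (_ / _); apply: eq_bigr => i _; rewrite addnC.
Qed.
End Coordinates.

Theorem proposition4p2 (R : realType) (n : nat) (hn : (1 <= n)%N) :
  forall f : ratfun R n,
    poisson_center f <->
    generated_subfield (fun g : ratfun R n =>
      (exists k : nat, (1 <= k <= n - 1)%N /\
         g = upper_right_minor R n k / lower_left_minor R n (n - k)) \/
      g = \det (coordmx R n)) f.
Proof.
case: n hn => // n _ f.
have t0 := @torus_coord_neq0 R n.
have tE := @log_canonical_center _ (@poisson R n.+1) _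
  (@FracField.tofrac _ \o @mpolyC (n.+1 * n.+1) _) n.+1
  (torus n.+1 (@coord R n)) (@poisson_biderivation R n.+1)
  (@poisson_const R n.+1)  (@ratfun_int_eq0 R n.+1) t0.
rewrite /poisson_center tE; last 2 first.
- apply: (@torus_bracket _ _ (fun k l => @pdiff R n.+1 (inord k) (inord l))).
  + exact: poisson_biderivation.
  + by move=> k l _ _; apply: pdiff_der.
  + exact: pdiff_coord_inord.
  + exact: coord_std.
- move=> G GK Gc Gt; apply: subfield_ratfun => // i j.
  have -> : coordmx R n.+1 i j = coord R n i j by rewrite /coord !inord_val.
  exact: (subfield_torus GK Gt).
split=> [fG F [F1 FB Fd] Fc FS|fF G GK Gc Gt].
  apply: (fG (fun g => g \in F)) => [||d dn]; [by split|exact: Fc|].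
  (* The shift 0 gives the determinant, and a shift [d > 0] the quotient with [k = n.+1 - d]. *)
  apply: FS; case: (posnP d) => [->|d0].
    by right; rewrite monomial_negashift_det.
  left; exists (n.+1 - d)%N; split; first by lia.
  by rewrite -monomial_negashift_minors ?subKn //; [apply: ltnW|lia].
(* Classical [asbool] turns the [Prop]-valued [G] into a predicate of the kind [generated_subfield]
   quantifies over. *)
have := fF (fun g => `[< G g >]); move=> /(_ _ _ _)/asboolP; apply.
- split=> [|g h|g h]; rewrite ?inE; first by apply/asboolP; apply: subfield1.
    rewrite -!topredE /= => /asboolP Gg /asboolP Gh.
    by apply/asboolP; apply: subfieldB.
  rewrite -!topredE /= => /asboolP Gg /asboolP Gh.
  by apply/asboolP; apply: subfield_div.
- by move=> c; apply/asboolP; apply: Gc.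
move=> g [[k [kn ->]]|->]; apply/asboolP.
  rewrite -monomial_negashift_minors; last by lia.
  by apply: Gt; lia.
by rewrite -monomial_negashift_det; apply: Gt.
Qed.
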